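(* Let $\{X_t\}$ be an irreducible, positive recurrent Markov chain on a countable state space $\Sigma$, let $i\in\Sigma$, $\epsilon,\alpha,\Delta\in(0,1)$, and run $\mathrm{IteratedRefinement}(i,\epsilon,\alpha)$. With probability $1$, the total number of iterations $k$ before the algorithm satisfies either $\hat\pi_i^{(k)}<\Delta/(1+\epsilon)$ or $\hat p^{(k)}<2\epsilon/3$ is bounded above by $$\log_2\left(\frac{3(1+\epsilon)}{2\epsilon\Delta}\right).$$ With probability greater than $1-\alpha$, the total number of random walk steps used by the algorithm (until one of these two conditions is satisfied) is bounded above by $$\tilde O\left(\frac{\ln(1/\alpha)}{\epsilon^3\Delta}\right).$$
   Context: Chain: $\{X_t\}_{t\ge0}$ is a discrete-time Markov chain with unique stationary distribution $\pi$; $T_i=\inf\{t\ge1:X_t=i\}$. Algorithm $\mathrm{IteratedRefinement}(i,\epsilon,\alpha)$: iterations $k=1,2,\dots$ with truncation thresholds $\theta^{(k)}=2^k$ and sample sizes $N^{(1)}=\lceil 6(1+\epsilon)\ln(8/\alpha)/\epsilon^2\rceil$, $N^{(k+1)}=\lceil 3(1+\epsilon)\theta^{(k+1)}\ln(4\theta^{(k+1)}/\alpha)/(\hat T_i^{(k)}\epsilon^2)\rceil$. In iteration $k$, $N^{(k)}$ fresh independent realizations of the chain started at $X_0=i$ are simulated, each stopped at the first time $t\ge1$ with $t=\theta^{(k)}$ or $X_t=i$; the $s$-th has length $t_s$ distributed as $\min(T_i,\theta^{(k)})$. Set $\hat T_i^{(k)}=\frac1{N^{(k)}}\sum_{s=1}^{N^{(k)}}t_s$,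 $\hat\pi_i^{(k)}=1/\hat T_i^{(k)}$, and let $\hat p^{(k)}$ be the fraction of the $N^{(k)}$ samples that are truncated (those with $T_i>\theta^{(k)}$). The number of random walk steps in iteration $k$ is $N^{(k)}\hat T_i^{(k)}$. Notation: $\tilde O(f(a)g(b))=O(f(a)\,\mathrm{polylog} f(a))\,O(g(b)\,\mathrm{polylog} g(b))$. *)

(* Defs.v *)
From HB Require Import structures.
From mathcomp Require Import all_boot all_order all_algebra.
From mathcomp Require Import all_classical all_reals all_analysis.
Set Implicit Arguments.
Unset Strict Implicit.
Unset Printing Implicit Defensive.
Import Order.TTheory GRing.Theory Num.Theory.
Import numFieldNormedType.Exports.
Local Open Scope classical_set_scope.
Local Open Scope ring_scope.

Definition stochastic (R : realType) (S : countType) (p : S -> S -> R) : Prop :=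
  (forall x y, 0 <= p x y) /\
  (forall x, (\esum_(y in [set: S]) (p x y)%:E = 1)%E).

Fixpoint nstep (R : realType) (S : countType) (p : S -> S -> R) (n : nat)
    (x y : S) : \bar R :=
  match n with
  | 0%N => ((x == y)%:R)%:E
  | m.+1 => (\esum_(z in [set: S]) ((p x z)%:E * nstep p m z y))%E
  end.

Definition irreducible (R : realType) (S : countType) (p : S -> S -> R) : Prop :=
  forall x y, exists n, (0 < nstep p n x y)%E.

(* [markov_chain P p j X]: under [P], [X] is a Markov chain with transition
   matrix [p] and [X 0 = j] almost surely.  The Markov property is written in
   product form, so that no conditioning on null events occurs. *)
Definition markov_chain (R : realType) (S : countType) (d : measure_display)
    (Omega : measurableType d) (P : probability Omega R) (p : S -> S -> R)
    (j : S) (X : nat -> Omega -> S) : Prop :=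
  [/\ forall t x, measurable [set w | X t w = x],
      P [set w | X 0%N w = j] = 1%E &
      forall (t : nat) (x : nat -> S),
        (P [set w | forall u, (u <= t.+1)%N -> X u w = x u] =
         P [set w | forall u, (u <= t)%N -> X u w = x u] *
         (p (x t) (x t.+1))%:E)%E].

(* [T_i = inf {t >= 1 : x_t = i}], equal to [+oo] when [i] is not revisited. *)
Definition return_time (R : realType) (S : countType) (i : S) (x : nat -> S) :
    \bar R :=
  ereal_inf [set (t%:R)%:E | t in [set t : nat | (0 < t)%N /\ x t = i]].

(* The law of a chain is determined by [p] and its initial state, so that the
   quantification over all chains with transition matrix [p] started at [j]
   only expresses E_j[T_j] < +oo. *)
Definition positive_recurrent (R : realType) (S : countType)
    (p : S -> S -> R) : Prop :=
  forall (j : S) (d : measure_display) (Omega : measurableType d)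
    (P : probability Omega R) (X : nat -> Omega -> S),
    markov_chain P p j X ->
    (\int[P]_w return_time R j (fun t => X t w) < +oo)%E.

Definition sigma_process (S : countType) (Omega : Type)
    (X : nat -> Omega -> S) : set (set Omega) :=
  <<s [set A | exists t x, A = [set w | X t w = x]] >>.

Definition independent_processes (R : realType) (S : countType)
    (d : measure_display) (Omega : measurableType d) (P : probability Omega R)
    (I : choiceType) (X : I -> nat -> Omega -> S) : Prop :=
  forall (J : seq I) (A : I -> set Omega), uniq J ->
    (forall j, j \in J -> sigma_process (X j) (A j)) ->
    P (\bigcap_(j in [set` J]) A j) = (\prod_(j <- J) P (A j))%E.

(* A run of IteratedRefinement, as a function of the simulated trajectories:
   [Y k s] is the full trajectory underlying sample [s] (counted from 0) of
   iteration [k] (counted from 1; the row [Y 0] is never read). *)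
Section IteratedRefinement.
Variables (R : realType) (S : countType) (i : S) (eps alpha : R).
Variable Y : nat -> nat -> nat -> S.

Definition theta (k : nat) : nat := (2 ^ k)%N.

Definition sample_length (k s : nat) : R :=
  fine (Order.min (return_time R i (Y k s)) ((theta k)%:R)%:E).

Definition truncated (k s : nat) : bool :=
  (((theta k)%:R)%:E < return_time R i (Y k s))%E.

Definition mean_length (k n : nat) : R :=
  (\sum_(s < n) sample_length k s) / n%:R.

Fixpoint sample_size (k : nat) : nat :=
  match k with
  | 0%N => 0%N
  | k'.+1 =>
    if k' == 0%N then
      `|Num.ceil (6 * (1 + eps) * ln (8 / alpha) / eps ^+ 2)|%N
    else
      `|Num.ceil (3 * (1 + eps) * (theta k'.+1)%:R *
                  ln (4 * (theta k'.+1)%:R / alpha) /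
                  (mean_length k' (sample_size k') * eps ^+ 2))|%N
  end.

Definition T_hat (k : nat) : R := mean_length k (sample_size k).

Definition pi_hat (k : nat) : R := (T_hat k)^-1.

Definition p_hat (k : nat) : R :=
  (\sum_(s < sample_size k) truncated k s)%N%:R / (sample_size k)%:R.

Definition walk_steps (k : nat) : R := (sample_size k)%:R * T_hat k.

Definition satisfied (Delta : R) (k : nat) : Prop :=
  pi_hat k < Delta / (1 + eps) \/ p_hat k < 2 * eps / 3.

Definition first_satisfied (Delta : R) (k : nat) : Prop :=
  [/\ (0 < k)%N, satisfied Delta k &
      forall j, (0 < j < k)%N -> ~ satisfied Delta j].

End IteratedRefinement.

(* [F = O(f polylog f)] on [D], where a polylog of [f] is a polynomial in
   [ln f] and the constant is uniform wherever [f] is bounded away from 0.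
   (A bound uniform up to [f = 0] is not what O means: for f = ln (1/alpha)
   the relevant regime is alpha -> 0, and f vanishes as alpha -> 1.) *)
Definition soft_bigO (R : realType) (T : Type) (D : set T) (F f : T -> R) :
    Prop :=
  exists q : {poly R}, forall c : R, 0 < c ->
  exists C : R, forall x, D x -> c <= f x ->
    `|F x| <= C * `|f x * q.[ln (f x)]|.

(* Main.v *)
(* If iteration k satisfies neither condition, then at least a fraction
   2 eps / 3 of its walks have length theta^(k), so that
   (2 eps / 3) theta^(k) <= T^(k) <= (1 + eps) / Delta; this bounds the number
   of iterations on every outcome.

   For the cost, let mu_k = E[min(T_i, theta^(k))], so that
   mu_k <= mu_(k+1) <= 2 mu_k. If T^(k-1) <= 3 mu_k, the sample size N^(k) is
   large enough for a Chernoff bound, valid uniformly in N^(k) because N^(k)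
   depends on earlier iterations only, to give
   mu_k / 8 <= T^(k) <= 3 mu_k up to probability alpha / (2 theta^(k)). These
   errors sum to less than alpha. Off the exceptional event T^(k) / T^(k-1) is
   at most 48, so iteration k costs O(theta^(k) ln(4 theta^(k) / alpha) /
   eps^2) steps, a geometric sum in k. Constant factors are used instead of
   1 - eps and 1 + eps because 1 - eps degenerates as eps tends to 1.

   All events are determined by finitely many return times capped at a common
   horizon, whose joint law is a finite product. *)
Require Import Defs.
From HB Require Import structures.
From mathcomp Require Import all_boot all_order all_algebra.
From mathcomp Require Import all_classical all_reals all_analysis.
From mathcomp Require Import zify ring lra.
Set Implicit Arguments.
Unset Strict Implicit.
Unset Printing Implicit Defensive.
Import Order.TTheory GRing.Theory Num.Theory.
Import numFieldNormedType.Exports.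
Local Open Scope classical_set_scope.
Local Open Scope ring_scope.

(** * Families of independent finite-valued variables *)

Section FiniteValued.
Variables (R : realType) (d : measure_display) (Omega : measurableType d).
Variable P : probability Omega R.

Definition pr (A : set Omega) : R := fine (P A).

Lemma prE (A : set Omega) : measurable A -> P A = (pr A)%:E.
Proof. by move=> mA; rewrite /pr fineK// fin_num_measure. Qed.

Lemma pr_ge0 (A : set Omega) : 0 <= pr A.
Proof. exact: fine_ge0. Qed.

Lemma le_pr (A B : set Omega) : measurable A -> measurable B -> A `<=` B ->
  pr A <= pr B.
Proof.
by move=> mA mB AB; rewrite -lee_fin -!prE// le_measure// inE.
Qed.

Lemma pr_le1 (A : set Omega) : measurable A -> pr A <= 1.
Proof. by move=> mA; rewrite -lee_fin -prE// probability_le1. Qed.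

Lemma prU_le (A B : set Omega) : measurable A -> measurable B ->
  pr (A `|` B) <= pr A + pr B.
Proof.
move=> mA mB; rewrite -lee_fin EFinD -!prE//; last exact: measurableU.
exact: measureU2.
Qed.

Lemma pr_total (T : finType) (U : Omega -> T) (E : set Omega) :
  (forall t, measurable (U @^-1` [set t])) -> measurable E ->
  pr E = \sum_t pr (E `&` U @^-1` [set t]).
Proof.
move=> mU mE.
have mEU t : measurable (E `&` U @^-1` [set t]) by exact: measurableI.
apply: EFin_inj; rewrite -prE//.
have {1}-> : E = \bigcup_(t in [set` index_enum T]) (E `&` U @^-1` [set t]).
  apply/seteqP; split=> [w Ew|w [t _ []]//]; exists (U w) => //.
  by rewrite /= mem_index_enum.
rewrite measure_fin_bigcup//; last by move=> a b _ _ [w [[_ <-] [_ <-]]].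
rewrite -fsbig_seq ?index_enum_uniq// -sumEFin.
apply: eq_bigr => t _ /=. exact: prE.
Qed.

Lemma measurable_preimage_fin (T : finType) (U : Omega -> T) (A : set T) :
  (forall t, measurable (U @^-1` [set t])) -> measurable (U @^-1` A).
Proof.
move=> mU; have -> : U @^-1` A = \bigcup_(t in A) U @^-1` [set t].
  apply/seteqP; split=> [w Aw|w [t At /= Uw]]; first by exists (U w).
  by rewrite /preimage/= Uw.
exact: fin_bigcup_measurable.
Qed.

Lemma pr_preimage (T : finType) (U : Omega -> T) (A : set T) :
  (forall t, measurable (U @^-1` [set t])) ->
  pr (U @^-1` A) = \sum_(t | t \in A) pr (U @^-1` [set t]).
Proof.
move=> mU; rewrite (pr_total mU) ?[RHS]big_mkcond/=; last first.
  exact: measurable_preimage_fin.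
apply: eq_bigr => t _; case: ifPn => [/set_mem At|/negP At].
  by congr pr; apply/seteqP; split=> [w []//|w /= Uw]; rewrite Uw.
suff -> : U @^-1` A `&` U @^-1` [set t] = set0 by rewrite /pr measure0.
by apply/seteqP; split=> // w [/= Aw Uw]; apply: At; rewrite inE -Uw.
Qed.

End FiniteValued.

(** * Events determined by finitely many members of an i.i.d. family *)

Section IndependentFamily.
Variables (R : realType) (d : measure_display) (Omega : measurableType d).
Variables (P : probability Omega R) (I : choiceType) (V : finType).
Variables (v0 : V) (D : I -> Omega -> V) (q : V -> R).
Hypothesis mD : forall j v, measurable (D j @^-1` [set v]).
Hypothesis indepD : forall (J : seq I) (v : I -> V), uniq J ->
  pr P (\bigcap_(j in [set` J]) (D j @^-1` [set v j])) = \prod_(j <- J) q (v j).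

Definition values (J : seq I) (w : Omega) : (size J).-tuple V :=
  map_tuple (D^~ w) (in_tuple J).

(** For finite [V] and [J] this amounts to membership in the sigma-algebra generated by the [D j]
    with [j] in [J], in a form that is checked pointwise. *)
Definition determined (J : seq I) (E : set Omega) :=
  forall w w', {in J, forall j, D j w = D j w'} -> E w -> E w'.

Lemma values_fiber (J : seq I) (u : (size J).-tuple V) : uniq J ->
  let v j := nth v0 u (index j J) in
  values J @^-1` [set u] = \bigcap_(j in [set` J]) (D j @^-1` [set v j])
  /\ map v J = u.
Proof.
move=> uJ v; split.
  apply/seteqP; split=> [w /= uw j /= jJ|w /= H].
    by rewrite /v -uw /values/= (nth_map j) ?index_mem// nth_index.
  apply: val_inj; apply: (@eq_from_nth _ v0); rewrite /= size_map ?size_tuple//.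
  move=> n nJ; have [j0 _] : exists j0 : I, True.
    by case: (J) nJ => // j0 ? _; exists j0.
  have := H (nth j0 J n); rewrite /= mem_nth// => /(_ isT).
  by rewrite (nth_map j0)// /v index_uniq.
apply: (@eq_from_nth _ v0); rewrite size_map ?size_tuple// => n nJ.
have [j0 _] : exists j0 : I, True by case: (J) nJ => // j0 ? _; exists j0.
by rewrite (nth_map j0)// /v index_uniq.
Qed.

Lemma measurable_values_fiber (J : seq I) (u : (size J).-tuple V) : uniq J ->
  measurable (values J @^-1` [set u]).
Proof.
move=> uJ; have [-> _] := values_fiber u uJ.
by apply: fin_bigcap_measurable => // j _; exact: mD.
Qed.

Lemma pr_values (J : seq I) (u : (size J).-tuple V) : uniq J ->
  pr P (values J @^-1` [set u]) = \prod_(v <- u) q v.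
Proof.
move=> uJ; have [-> uE] := values_fiber u uJ.
by rewrite indepD// -[in RHS]uE big_map.
Qed.

Lemma determinedE (J : seq I) (E : set Omega) : determined J E ->
  E = values J @^-1` (values J @` E).
Proof.
move=> dE; apply/seteqP; split=> [w Ew|w [w' Ew' ww']]; first by exists w.
apply: dE Ew' => j jJ.
have := congr1 (fun t : (size J).-tuple V => nth v0 t (index j J)) ww'.
by rewrite /= !(nth_map j) ?index_mem// nth_index.
Qed.

Lemma sub_determined (J J' : seq I) (E : set Omega) :
  {subset J <= J'} -> determined J E -> determined J' E.
Proof. by move=> JJ' dE w w' ww'; apply: dE => j /JJ'; exact: ww'. Qed.

Lemma determinedI (J : seq I) (A B : set Omega) :
  determined J A -> determined J B -> determined J (A `&` B).
Proof. by move=> dA dB w w' ww' [/(dA _ _ ww') ? /(dB _ _ ww')]. Qed.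

Lemma determined_measurable (J : seq I) (E : set Omega) : uniq J ->
  determined J E -> measurable E.
Proof.
move=> uJ /determinedE ->; apply: measurable_preimage_fin => t.
exact: measurable_values_fiber.
Qed.

Lemma determined_pr (J : seq I) (E : set Omega) : uniq J -> determined J E ->
  pr P E = \sum_(u | u \in values J @` E) \prod_(v <- u) q v.
Proof.
move=> uJ /determinedE {1}->; rewrite pr_preimage => [|t]; last first.
  exact: measurable_values_fiber.
by apply: eq_bigr => u _; rewrite pr_values.
Qed.

(** Each probability is a sum of product weights over tuples. The product of the two sums runs over
    pairs, and the weight of a pair is that of its concatenation, a tuple over the repetition-free
    [J1 ++ J2]. *)
Lemma determined_indep (J1 J2 : seq I) (E1 E2 : set Omega) :
  uniq (J1 ++ J2) -> determined J1 E1 -> determined J2 E2 ->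
  pr P (E1 `&` E2) = pr P E1 * pr P E2.
Proof.
move=> u12 dE1 dE2; have /and3P[uJ1 _ uJ2] : [&& uniq J1, true & uniq J2].
  by move: u12; rewrite cat_uniq => /and3P[-> _ ->].
rewrite (determined_pr uJ1 dE1) (determined_pr uJ2 dE2).
pose U w := (values J1 w, values J2 w).
have UE u1 u2 : U @^-1` [set (u1, u2)] =
    values J1 @^-1` [set u1] `&` values J2 @^-1` [set u2].
  apply/seteqP; split=> w /=; first by case=> h1 h2; split.
  by case=> /= h1 h2; rewrite /U h1 h2.
have mU t : measurable (U @^-1` [set t]).
  by case: t => u1 u2; rewrite UE; apply: measurableI;
    exact: measurable_values_fiber.
have -> : E1 `&` E2 = U @^-1` ((values J1 @` E1) `*` (values J2 @` E2)).
  by rewrite {1}(determinedE dE1) {1}(determinedE dE2).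
rewrite pr_preimage// big_distrlr/= pair_big_dep/=.
apply: eq_big => [[u1 u2]|[u1 u2] _]; first by rewrite in_setX.
rewrite UE -big_cat.
have c : size (J1 ++ J2) = (size J1 + size J2)%N by rewrite size_cat.
pose u := tcast (esym c) [tuple of u1 ++ u2].
have uE : tval u = u1 ++ u2 by rewrite /u val_tcast.
rewrite -uE -pr_values//; congr (pr P _).
apply/seteqP; split => w /=.
  by case=> h1 h2; apply: val_inj; rewrite [RHS]uE -h1 -h2/= map_cat.
move=> /(congr1 val); rewrite [X in _ = X -> _]uE /= map_cat => /eqP.
rewrite eqseq_cat ?size_map ?size_tuple// => /andP[/eqP h1 /eqP h2].
by split; exact: val_inj.
Qed.

End IndependentFamily.

(** * Chernoff bounds *)

(** With [F v] equal to [q v * expR (t * x v)], this factorizes the exponential moment of a sum of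
    [n] independent copies. *)
Lemma sum_prod_tuple (R : realType) (V : finType) (n : nat) (F : V -> R) :
  \sum_(u : n.-tuple V) \prod_(v <- u) F v = (\sum_v F v) ^+ n.
Proof.
rewrite -[in RHS](card_ord n) -prodr_const.
rewrite (bigA_distr_bigA (fun (_ : 'I_n) v => F v)) /=.
rewrite (reindex (fun f : {ffun 'I_n -> V} => mktuple f)) /=; last first.
  exists (fun u : n.-tuple V => [ffun i => tnth u i]) => [f _|u _].
    by apply/ffunP => i; rewrite ffunE tnth_mktuple.
  by apply: eq_from_tnth => i; rewrite tnth_mktuple ffunE.
by apply: eq_bigr => f _; rewrite big_map big_enum.
Qed.

(** Invert [1 - y <= expR (- y)] at y = x / 2 and use (1 - x / 2) (1 + x) >= 1 on [0, 1]. *)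
Lemma expR_half_le (R : realType) (x : R) : 0 <= x <= 1 ->
  expR (2^-1 * x) <= 1 + x.
Proof.
move=> x01; have := expR_ge1Dx (- (2^-1 * x)); rewrite expRN => h.
have e0 := expR_gt0 (2^-1 * x).
have {}h : (1 - 2^-1 * x) * expR (2^-1 * x) <= 1.
  by rewrite -[leRHS](mulVf (lt0r_neq0 e0)) ler_wpM2r// ltW.
nra.
Qed.

(** Squaring [1 + x <= expR x] bounds the left side by (1 + x)^-2, which leaves a cubic inequality
    on [0, 1]. *)
Lemma expRN2_le (R : realType) (x : R) : 0 <= x <= 1 ->
  expR (- 2 * x) <= 1 - 3 / 4 * x.
Proof.
move=> x01; have h := expR_ge1Dx x; have e0 := expR_gt0 (- 2 * x).
have e : expR (- 2 * x) * (expR x * expR x) = 1.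
  by rewrite -!expRD -[RHS](@expR0 R); congr expR; ring.
have h2 : (1 + x) * (1 + x) <= expR x * expR x.
  by apply: ler_pM => //; lra.
have h3 : expR (- 2 * x) * ((1 + x) * (1 + x)) <= 1.
  by rewrite -[leRHS]e ler_wpM2l// ltW.
have h4 : 1 <= (1 - 3 / 4 * x) * ((1 + x) * (1 + x)).
  (* The excess of the product in [h4] over 1 is a quarter of this expression. *)
  have : 0 <= x * (1 - x) * (5 + 3 * x) by rewrite !mulr_ge0//; lra.
  lra.
have h5 : 0 < (1 + x) * (1 + x) by rewrite mulr_gt0//; lra.
by rewrite -(ler_pM2r h5); exact: le_trans h4.
Qed.

Section Chernoff.
Variables (R : realType) (V : finType) (q x : V -> R).
Hypotheses (q_ge0 : forall v, 0 <= q v) (q_sum1 : \sum_v q v = 1).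
Hypothesis x01 : forall v, 0 <= x v <= 1.

Let m : R := \sum_v q v * x v.

(** Markov's inequality for the exponential of [t] times the sum. By [ht] the exponential moment of
    one sample is at most 1 + h m <= expR (h m). The sign of [t] is free, so both tails are
    instances. *)
Lemma chernoff (n : nat) (t h a : R) :
  (forall v, expR (t * x v) <= 1 + h * x v) ->
  \sum_(u : n.-tuple V | a <= t * \sum_(v <- u) x v) \prod_(v <- u) q v
  <= expR (h * m * n%:R - a).
Proof.
move=> ht; rewrite expRB ler_pdivlMr ?expR_gt0// mulr_suml.
apply: (@le_trans _ _
  (\sum_(u : n.-tuple V) \prod_(v <- u) (q v * expR (t * x v)))).
  rewrite [leLHS]big_mkcond/=; apply: ler_sum => u _.
  rewrite big_split/= -expR_sum -mulr_sumr.
  case: ifP => au; last by rewrite mulr_ge0 ?expR_ge0// prodr_ge0.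
  by rewrite ler_wpM2l ?prodr_ge0// ler_expR.
rewrite sum_prod_tuple expRM_natr; apply: lerXn2r.
- by rewrite nnegrE sumr_ge0// => v _; rewrite mulr_ge0 ?expR_ge0.
- by rewrite nnegrE expR_ge0.
apply: le_trans (expR_ge1Dx _).
rewrite -q_sum1 /m mulr_sumr -big_split/=; apply: ler_sum => v _.
by rewrite mulrCA -[X in X + _]mulr1 -mulrDr ler_wpM2l.
Qed.

End Chernoff.

Lemma pr_mean_deviation (R : realType) (d : measure_display)
    (Omega : measurableType d) (P : probability Omega R) (I : choiceType)
    (V : finType) (v0 : V) (D : I -> Omega -> V) (q x : V -> R)
    (J : seq I) (mn : R) :
  (forall j v, measurable (D j @^-1` [set v])) ->
  (forall (J : seq I) (v : I -> V), uniq J ->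
    pr P (\bigcap_(j in [set` J]) (D j @^-1` [set v j])) =
    \prod_(j <- J) q (v j)) ->
  (forall v, 0 <= q v) -> \sum_v q v = 1 -> (forall v, 0 <= x v <= 1) ->
  uniq J ->
  mn = (\sum_v q v * x v) * (size J)%:R ->
  pr P [set w | ~ (mn / 8 <= \sum_(j <- J) x (D j w) <= 3 * mn)]
    <= 2 * expR (- (mn / 2)).
Proof.
move=> mD iD q0 q1 x01 uJ mnE; set E := [set w | _].
have dE : determined D J E.
  move=> w w' ww'; rewrite /E/=.
  suff -> : \sum_(j <- J) x (D j w) = \sum_(j <- J) x (D j w') by [].
  by apply: eq_big_seq => j jJ; rewrite ww'.
rewrite (determined_pr v0 mD iD uJ dE).
(* [expR (x / 2) <= 1 + x] handles the upper tail at [3 * mn] and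
   [expR (- 2 * x) <= 1 - 3 / 4 * x] the lower tail at [mn / 8]; both leave
   the exponent [- mn / 2]. *)
have up := @chernoff R V q x q0 q1 (size J) 2^-1 1 (3 / 2 * mn).
have lo := @chernoff R V q x q0 q1 (size J) (- 2) (- (3 / 4)) (- (mn / 4)).
have {}up := up (fun v => _); have {}lo := lo (fun v => _).
apply: (@le_trans _ _ (expR (- (mn / 2)) + expR (- (mn / 2)))); last lra.
apply: le_trans (lerD _ _); [|apply: le_trans (up _) _|apply: le_trans (lo _) _].
(* Union bound, term by term: a deviating tuple lies in one of the two tails, and all weights are
   nonnegative. *)
- rewrite [leLHS]big_mkcond [X in _ <= X + _]big_mkcond.
  rewrite [X in _ <= _ + X]big_mkcond/= -big_split/=; apply: ler_sum => u _.
  have u0 : 0 <= \prod_(v <- u) q v by exact: prodr_ge0.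
  have [uE|_] := boolP (u \in _); last by case: ifP; case: ifP => _ _; lra.
  move: uE; rewrite inE => -[w Ew <-]; rewrite /= !big_map/=.
  have {}u0 : 0 <= \prod_(j <- J) q (D j w) by exact: prodr_ge0.
  case: ifPn => h1; case: ifPn => h2; try lra.
  exfalso; apply: Ew; apply/andP; split; lra.
- by move=> v; rewrite mul1r; exact: expR_half_le.
- rewrite ler_expR mul1r -mnE; lra.
- by move=> v; rewrite [in leRHS]mulNr; exact: expRN2_le.
- have -> : - (3 / 4) * (\sum_v q v * x v) * (size J)%:R = - (3 / 4) * mn.
    by rewrite mnE mulrA.
  rewrite ler_expR; lra.
Qed.

(** * Finite-horizon events of a Markov chain *)

Section FiniteHorizon.
Variables (S : countType) (i : S) (Omega : Type).

Definition same_until (n : nat) (x y : nat -> S) :=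
  forall t, (t <= n)%N -> x t = y t.

Definition cylinder (X : nat -> Omega -> S) (n : nat) (x : nat -> S) :=
  [set w | forall u, (u <= n)%N -> X u w = x u].

(** Since [S] is countable, an event up to time [n] is a countable disjoint union of cylinders,
    indexed here by the codes of the state sequences of length [n.+1] that satisfy [Q]. All other
    indices give the empty set; [nth i c] pads with [i] beyond the horizon. *)
Definition piece (Q : (nat -> S) -> Prop) (n : nat) (X : nat -> Omega -> S)
    (m : nat) : set Omega :=
  if pickle_inv m is Some c then
    if `[< size (c : seq S) = n.+1 /\ Q (nth i c) >]
    then cylinder X n (nth i c) else set0
  else set0.

Lemma bigcup_piece (Q : (nat -> S) -> Prop) n (X : nat -> Omega -> S) :
  (forall x y, same_until n x y -> Q x -> Q y) ->
  [set w | Q (X ^~ w)] = \bigcup_m piece Q n X m.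
Proof.
move=> dQ; apply/seteqP; split=> [w Qw|w [m _]]; last first.
  rewrite /piece; case: (pickle_inv m) => // c; case: asboolP => // -[_ Qc] H.
  by apply: dQ Qc => t tn; rewrite H.
pose c := [seq X t w | t <- iota 0 n.+1].
have cE t : (t <= n)%N -> nth i c t = X t w.
  by move=> tn; rewrite (nth_map 0%N) ?size_iota// nth_iota.
exists (pickle c) => //; rewrite /piece pickleK_inv; case: asboolP => [_ u un|[]].
  by rewrite cE.
split; first by rewrite size_map size_iota.
by apply: dQ Qw => t tn; rewrite cE.
Qed.

Lemma trivIset_piece Q n (X : nat -> Omega -> S) :
  trivIset setT (piece Q n X).
Proof.
move=> a b _ _ [w []]; rewrite /piece.
case Ea: (pickle_inv a) => [ca|//]; case: asboolP => // -[sa _] Ha.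
case Eb: (pickle_inv b) => [cb|//]; case: asboolP => // -[sb _] Hb.
have cab : ca = cb.
  apply: (@eq_from_nth _ i); rewrite sa ?sb// => t; rewrite ltnS => tn.
  by rewrite -Ha// Hb.
have := @pickle_invK (seq S) a; have := @pickle_invK (seq S) b.
by rewrite Ea Eb /= cab => -> ->.
Qed.

Lemma sigma_process_cylinder (X : nat -> Omega -> S) n x :
  sigma_process X (cylinder X n x).
Proof.
have sX t : sigma_process X [set w | X t w = x t].
  by apply: sub_sigma_algebra; exists t, (x t).
elim: n => [|n IHn].
  suff -> : cylinder X 0 x = [set w | X 0%N w = x 0%N] by exact: sX.
  apply/seteqP; split=> w /=; first exact.
  by move=> X0 u; rewrite leqn0 => /eqP ->.
have -> : cylinder X n.+1 x =
    ~` (~` cylinder X n x `|` ~` [set w | X n.+1 w = x n.+1]).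
  rewrite -setCI setCK; apply/seteqP; split=> w /= => [H|[H Xn] u].
    by split=> [u un|]; apply: H => //; exact: leqW.
  by rewrite leq_eqVlt => /predU1P[-> //|]; rewrite ltnS; exact: H.
have sC A : sigma_process X A -> sigma_process X (~` A).
  by rewrite -setTD; exact: sigma_algebraCD.
apply: (sC _); rewrite -bigcup2E; apply: sigma_algebra_bigcup => -[|[|k]];
  rewrite /bigcup2/=; [exact: sC|exact: sC|exact: sigma_algebra0].
Qed.

(** This is what lets [independent_processes] apply to finite-horizon events. *)
Lemma sigma_process_finite_horizon (Q : (nat -> S) -> Prop) n
    (X : nat -> Omega -> S) :
  (forall x y, same_until n x y -> Q x -> Q y) ->
  sigma_process X [set w | Q (X ^~ w)].
Proof.
move=> dQ; rewrite (bigcup_piece X dQ); apply: sigma_algebra_bigcup => m.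
rewrite /piece; case: (pickle_inv m) => [c|]; last exact: sigma_algebra0.
case: asboolP => _; last exact: sigma_algebra0.
exact: sigma_process_cylinder.
Qed.

End FiniteHorizon.

(** * Uniqueness of the finite-horizon law of a chain *)

Section MarkovLaw.
Variables (R : realType) (S : countType) (d : measure_display).
Variables (Omega : measurableType d) (P : probability Omega R).
Variables (p : S -> S -> R) (i : S).

Lemma markov_chain_measurable (X : nat -> Omega -> S) (A : set Omega) :
  markov_chain P p i X -> sigma_process X A -> measurable A.
Proof.
case=> mX _ _; apply: smallest_sub; first exact: sigma_algebra_measurable.
by move=> _ [t [x ->]]; exact: mX.
Qed.

Lemma markov_chain_cylinder (X X' : nat -> Omega -> S) n x :
  markov_chain P p i X -> markov_chain P p i X' ->
  P (cylinder X n x) = P (cylinder X' n x).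
Proof.
move=> [mX X0 XS] [mX' X'0 X'S]; elim: n => [|n IHn]; last first.
  by rewrite /cylinder XS X'S -/(cylinder _ _ _) IHn.
have E (Y : nat -> Omega -> S) :
    (forall t x, measurable [set w | Y t w = x]) ->
    P [set w | Y 0%N w = i] = 1%E ->
    P (cylinder Y 0 x) = if x 0%N == i then 1%E else 0%E.
  move=> mY Y0; have -> : cylinder Y 0 x = [set w | Y 0%N w = x 0%N].
    apply/seteqP; split=> w /=; first exact.
    by move=> Yx u; rewrite leqn0 => /eqP ->.
  case: eqP => [->//|xi]; apply/eqP; rewrite eq_le measure_ge0 andbT.
  have <- : (P (~` [set w | Y 0%N w = i]) = 0)%E.
    by rewrite probability_setC// Y0 subee.
  rewrite le_measure ?inE//; first exact: measurableC.
  by move=> w /= -> ?; exact: xi.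
by rewrite (E X)// (E X').
Qed.

(** Cylinders have equal probabilities, and countable additivity extends this to finite-horizon
    events. It makes all samples identically distributed up to a fixed time. *)
Lemma markov_chain_law (X X' : nat -> Omega -> S) (Q : (nat -> S) -> Prop) n :
  (forall x y, same_until n x y -> Q x -> Q y) ->
  markov_chain P p i X -> markov_chain P p i X' ->
  P [set w | Q (X ^~ w)] = P [set w | Q (X' ^~ w)].
Proof.
move=> dQ cX cX'; rewrite !(bigcup_piece i _ dQ).
have mpiece Y m : markov_chain P p i Y -> measurable (piece i Q n Y m).
  move=> cY; rewrite /piece; case: (pickle_inv m) => // c; case: asboolP => // _.
  by apply: (markov_chain_measurable cY); exact: sigma_process_cylinder.
rewrite !measure_bigcup//; try exact: trivIset_piece;
  try by move=> m _; exact: mpiece.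
apply: eq_eseriesr => m _.
rewrite /piece; case: (pickle_inv m) => // c; case: asboolP => // _.
exact: markov_chain_cylinder.
Qed.

End MarkovLaw.

(** * Capped return times *)

Section ReturnTime.
Variables (R : realType) (S : countType) (i : S).

(* One less than the number of steps of a walk truncated at time [h.+1]. *)
Definition hit (h : nat) (x : nat -> S) : nat :=
  find (fun t => x t.+1 == i) (iota 0 h).

Lemma hit_le h x : (hit h x <= h)%N.
Proof. by rewrite -[leqRHS](size_iota 0 h) find_size. Qed.

Lemma eq_hit h x y : same_until h x y -> hit h x = hit h y.
Proof.
move=> xy; apply: eq_in_find => t; rewrite mem_iota => /= th.
by rewrite xy.
Qed.

(** [find] returns [h] when the search fails, so [hit h x = h] encodes a return after time [h],
    possibly never. *)
Lemma return_time_hit h x :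
  if (hit h x < h)%N then return_time R i x = ((hit h x).+1%:R)%:E
  else (h.+1%:R%:E <= return_time R i x)%E.
Proof.
have no t : (t < hit h x)%N -> x t.+1 <> i.
  move=> th; have th' := leq_trans th (hit_le h x).
  by have /negbT/eqP := before_find 0%N th; rewrite nth_iota.
have lb : ((hit h x).+1%:R%:E <= return_time R i x)%E.
  apply: le_ereal_inf_tmp => _ /= [[|t] [//= _ xt] <-].
  rewrite lee_fin ler_nat ltnS leqNgt; apply/negP => /no; exact.
case: ifPn => [hh|]; last first.
  rewrite -leqNgt => hh; suff e : hit h x = h by rewrite e in lb.
  by apply/eqP; rewrite eqn_leq hit_le hh.
apply/eqP; rewrite eq_le lb andbT; apply: ereal_inf_lbound => /=.
exists (hit h x).+1 => //; split=> //.
have := hh; rewrite -{2}(size_iota 0 h) -has_find => /(nth_find 0%N)/eqP.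
by rewrite -/(hit h x) nth_iota.
Qed.

(** One index [hit h x] yields the walk lengths for all thresholds up to [h], also when the return
    time is infinite. *)
Lemma min_return_time h n x : (n <= h)%N ->
  Order.min (return_time R i x) (n%:R)%:E = ((minn (hit h x).+1 n)%:R)%:E.
Proof.
move=> nh; have := return_time_hit h x; case: ifPn => [_ ->|hh le].
  by rewrite -EFin_min -natr_min.
rewrite min_r; last first.
  by apply: le_trans le; rewrite lee_fin ler_nat leqW.
by congr (_%:R%:E); rewrite -leqNgt in hh; lia.
Qed.

Lemma lt_return_time h n x : (n <= h)%N ->
  ((n%:R)%:E < return_time R i x)%E = (n < (hit h x).+1)%N.
Proof.
move=> nh; have := return_time_hit h x; case: ifPn => [_ ->|hh le].
  by rewrite lte_fin ltr_nat.
rewrite (lt_le_trans _ le) ?lte_fin ?ltr_nat//.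
by rewrite -leqNgt in hh; apply/esym; lia.
Qed.

End ReturnTime.

Lemma ceil_absz_itv (R : realType) (x : R) : 0 <= x ->
  x <= (`|Num.ceil x|%N)%:R <= x + 1.
Proof.
move=> x0; have c0 : 0 <= Num.ceil x by rewrite ceil_ge0; lra.
rewrite natr_absz ger0_norm// ceil_ge/=.
have := ceilB1_lt x; rewrite intrD; lra.
Qed.

Lemma ceil_absz_le (R : realType) (x y : R) : 0 <= x -> x <= y ->
  (`|Num.ceil x|%N <= `|Num.ceil y|%N)%N.
Proof.
move=> x0 xy; have cxy : Num.ceil x <= Num.ceil y by exact: le_ceil.
have : 0 <= Num.ceil x by rewrite ceil_ge0; lra.
lia.
Qed.

(** * Deterministic analysis of a run *)

Section Run.
Variables (R : realType) (S : countType) (i : S) (eps alpha : R).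
Hypotheses (eps01 : 0 < eps < 1) (alpha01 : 0 < alpha < 1).

Let eps_gt0 : 0 < eps. Proof. by case/andP: eps01. Qed.
Let alpha_gt0 : 0 < alpha. Proof. by case/andP: alpha01. Qed.

Definition log_term (k : nat) : R := ln (4 * (theta k)%:R / alpha).

(* [N^(k) = ceil (budget k / T^(k-1))], with [T^(0) = 1]. *)
Definition budget (k : nat) : R :=
  3 * (1 + eps) * (theta k)%:R * log_term k / eps ^+ 2.

(** Bounds N^(k) on every outcome, because the preceding mean is at least 1 ([sample_size_bound]);
    thus an iteration can only read finitely many samples. *)
Definition size_bound (k : nat) : nat := `|Num.ceil (budget k)|%N.

Lemma theta_ge1 k : (1 <= (theta k)%:R :> R).
Proof. by rewrite ler1n expn_gt0. Qed.

Lemma thetaS k : (theta k.+1)%:R = 2 * (theta k)%:R :> R.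
Proof. by rewrite /theta expnS natrM. Qed.

Lemma log_term_gt0 k : 0 < log_term k.
Proof.
have th := theta_ge1 k; apply: ln_gt0; rewrite ltr_pdivlMr//.
by case/andP: alpha01 => _ ?; lra.
Qed.

(** The reason for 4 theta / alpha inside the logarithm: each of the two Chernoff tails costs at
    most alpha / (4 theta). *)
Lemma expRN_log_term k : expR (- log_term k) = alpha / (4 * (theta k)%:R).
Proof.
have th := theta_ge1 k; have a0 := alpha_gt0.
rewrite expRN /log_term lnK ?invf_div// posrE.
by rewrite divr_gt0//; lra.
Qed.

Lemma budget_gt0 k : 0 < budget k.
Proof.
have th := theta_ge1 k; have e0 := eps_gt0; rewrite /budget divr_gt0 ?exprn_gt0//.
by rewrite mulr_gt0 ?log_term_gt0// !mulr_gt0//; lra.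
Qed.

Section FixedTrajectories.
Variable Y : nat -> nat -> nat -> S.

Let len := @sample_length R S i Y.
Let mean := @mean_length R S i Y.
Let size_ := sample_size i eps alpha Y.
Let T := T_hat i eps alpha Y.

Lemma sample_lengthE h k s : (theta k <= h)%N ->
  len k s = (minn (hit i h (Y k s)).+1 (theta k))%:R.
Proof. by move=> kh; rewrite /len /sample_length (min_return_time R i _ kh). Qed.

Lemma truncatedE h k s : (theta k <= h)%N ->
  truncated R i Y k s = (theta k < (hit i h (Y k s)).+1)%N.
Proof. by move=> kh; rewrite /truncated (lt_return_time R i _ kh). Qed.

Lemma sample_length_itv k s : 1 <= len k s <= (theta k)%:R.
Proof.
rewrite (sample_lengthE s (leqnn (theta k))) ler1n ler_nat geq_minr andbT.
by rewrite leq_min expn_gt0.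
Qed.

Lemma mean_length_itv k n : (0 < n)%N -> 1 <= mean k n <= (theta k)%:R.
Proof.
move=> n0; have n0' : 0 < n%:R :> R by rewrite ltr0n.
rewrite /mean /mean_length ler_pdivlMr// ler_pdivrMr//.
have cst (c : R) : c * n%:R = \sum_(s < n) c.
  by rewrite sumr_const card_ord mulr_natr.
rewrite !cst.
by apply/andP; split; apply: ler_sum => s _; case/andP: (sample_length_itv k s).
Qed.

(** At [k = 0], [T_hat] is an empty mean with value 0; the value 1 instead turns the first sample
    size into an instance of the general formula. *)
Definition previous_mean (k : nat) : R := if k == 0%N then 1 else T k.

Lemma sample_sizeS k :
  size_ k.+1 = `|Num.ceil (budget k.+1 / previous_mean k)|%N.
Proof.
rewrite /size_ /= /previous_mean; case: eqP => [->|_].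
  congr (`|Num.ceil _|%N); rewrite divr1 /budget /log_term /theta expn1.
  have -> : 4 * 2%:R / alpha = 8 / alpha :> R by congr (_ / _); ring.
  by congr (_ / _); ring.
congr (`|Num.ceil _|%N); rewrite -/(T_hat i eps alpha Y k) -/(log_term k.+1).
by rewrite /budget -/T [T k * _]mulrC invfM !mulrA.
Qed.

(** A joint induction: a preceding mean of at least 1 makes the sample size positive, and a nonempty
    sample has a mean of at least 1. *)
Lemma sample_size_T_hat k :
  [/\ 1 <= previous_mean k, (0 < size_ k.+1)%N &
      1 <= T k.+1 <= (theta k.+1)%:R].
Proof.
have p1_step j : 1 <= previous_mean j ->
    (0 < size_ j.+1)%N /\ 1 <= T j.+1 <= (theta j.+1)%:R.
  move=> p1; have s0 : (0 < size_ j.+1)%N.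
    rewrite sample_sizeS absz_gt0 ceil_neq0 divr_gt0 ?orbT ?budget_gt0//.
    exact: lt_le_trans p1.
  by split=> //; exact: mean_length_itv.
elim: k => [|k [_ _ /andP[IH _]]].
  have p1 : 1 <= previous_mean 0 by [].
  by have [] := p1_step _ p1.
have p1 : 1 <= previous_mean k.+1 by [].
by have [] := p1_step _ p1.
Qed.

Lemma previous_mean_ge1 k : 1 <= previous_mean k.
Proof. by have [] := sample_size_T_hat k. Qed.

Lemma sample_size_gt0 k : (0 < size_ k.+1)%N.
Proof. by have [] := sample_size_T_hat k. Qed.

Lemma T_hat_itv k : 1 <= T k.+1 <= (theta k.+1)%:R.
Proof. by have [] := sample_size_T_hat k. Qed.

Lemma sample_size_itv k :
  budget k.+1 / previous_mean k <= (size_ k.+1)%:R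
    <= budget k.+1 / previous_mean k + 1.
Proof.
rewrite sample_sizeS ceil_absz_itv// divr_ge0 ?(ltW (budget_gt0 _))//.
exact: le_trans (previous_mean_ge1 k).
Qed.

Lemma sample_size_bound k : (size_ k <= size_bound k)%N.
Proof.
case: k => // k; rewrite sample_sizeS; have p1 := previous_mean_ge1 k.
have p0 : 0 < previous_mean k by exact: lt_le_trans p1.
apply: ceil_absz_le; first by rewrite divr_ge0 ?(ltW (budget_gt0 _))// ltW.
by rewrite ler_pdivrMr// ler_peMr// ltW// budget_gt0.
Qed.

Lemma p_hat_theta_le k : p_hat i eps alpha Y k.+1 * (theta k.+1)%:R <= T k.+1.
Proof.
have s0 := sample_size_gt0 k; rewrite /T /T_hat /p_hat /mean_length mulrAC.
rewrite ler_pM2r ?invr_gt0 ?ltr0n// natr_sum mulr_suml; apply: ler_sum => s _.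
have := sample_lengthE s (leqnn (theta k.+1)); rewrite /len => ->.
have -> := truncatedE s (leqnn (theta k.+1)).
by case: ltnP => ?; rewrite ?mul1r ?mul0r// ler_nat; lia.
Qed.

Variable Delta : R.
Hypothesis Delta01 : 0 < Delta < 1.

Lemma unsatisfied_theta_le k :
  ~ satisfied i eps alpha Y Delta k.+1 ->
  (theta k.+1)%:R <= 3 * (1 + eps) / (2 * eps * Delta).
Proof.
move=> /not_orP[/negP]; rewrite -leNgt /pi_hat -/T => pi_ge /negP.
rewrite -leNgt => p_ge.
have e0 := eps_gt0; have D0 : 0 < Delta by case/andP: Delta01.
have /andP[T1 _] := T_hat_itv k; have T0 : 0 < T k.+1 by exact: lt_le_trans T1.
have th := theta_ge1 k.+1; have pT := p_hat_theta_le k.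
have TD : T k.+1 * Delta <= 1 + eps.
  move: pi_ge; rewrite ler_pdivrMr; last lra.
  by rewrite mulrC ler_pdivlMr// mulrC.
rewrite ler_pdivlMr; last by rewrite !mulr_gt0.
have : 2 * eps / 3 * (theta k.+1)%:R <= T k.+1.
  by apply: le_trans pT; rewrite ler_wpM2r//; lra.
rewrite -(ler_pM2r D0); lra.
Qed.

(** The last unsatisfied iteration is [k.-1], whence the exponent. *)
Lemma first_satisfied_theta_le k :
  first_satisfied i eps alpha Y Delta k ->
  (2 ^ k.-1)%:R <= 3 * (1 + eps) / (2 * eps * Delta).
Proof.
have e0 := eps_gt0; have /andP[D0 D1] := Delta01; have /andP[_ e1] := eps01.
case: k => [[]//|[_|k [_ _]]] /=.
  (* For [k = 1] no iteration precedes, and the bound reads 1 <= 3 (1 + eps) / (2 eps Delta). *)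
  rewrite ler_pdivlMr ?mulr_gt0// mul1r.
  have : eps * Delta <= eps by rewrite ler_piMr// ltW.
  lra.
by move=> /(_ k.+1); rewrite ltnS leqnn => /(_ isT)/unsatisfied_theta_le.
Qed.

Lemma first_satisfied_exists : exists k, first_satisfied i eps alpha Y Delta k.
Proof.
pose B : R := 3 * (1 + eps) / (2 * eps * Delta).
have [n Bn] : exists n, B < (2 ^ n)%:R.
  exists (Num.bound B); apply: (lt_le_trans (archi_boundP _)).
    have e0 := eps_gt0; have /andP[D0 D1] := Delta01.
    by rewrite divr_ge0// ltW// !mulr_gt0//; lra.
  by rewrite ler_nat ltnW// ltn_expl.
have ex : exists k, (0 < k)%N && `[< satisfied i eps alpha Y Delta k >].
  exists n.+1 => /=; apply/asboolP; apply: contrapT => /unsatisfied_theta_le.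
  rewrite -/B => /le_lt_trans/(_ Bn); rewrite ltr_nat /theta ltn_exp2l//.
  by rewrite ltnNge leqnSn.
case: (ex_minnP ex) => k /andP[k0 /asboolP sk] kmin; exists k; split=> // j.
move=> /andP[j0 jk] sj; have := kmin j; rewrite j0/= leqNgt jk => /(_ _)/negP.
by apply=> //; exact/asboolP.
Qed.

Lemma sum_theta_le K : \sum_(1 <= j < K.+1) (theta j)%:R <= 2 * (theta K)%:R :> R.
Proof.
elim: K => [|K IH]; first by rewrite big_nil mulr_ge0.
by rewrite big_nat_recr//= thetaS; lra.
Qed.

Lemma log_term_le j k : (j <= k)%N -> log_term j <= log_term k.
Proof.
move=> jk; have a0 := alpha_gt0; have tj := theta_ge1 j; have tk := theta_ge1 k.
rewrite ler_ln ?posrE ?divr_gt0//; try lra.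
by rewrite ler_pM2r ?invr_gt0// ler_pM2l// ler_nat leq_exp2l.
Qed.

(* [48 = 3 * 2 * 8] bounds the ratio of consecutive means, and
   [288 = 48 * 3 * 2] absorbs the factor [3 * (1 + eps)] of the budget. *)
Lemma sum_walk_steps_le (mu : nat -> R) K :
  (forall k, 0 < mu k) -> (forall k, mu k.+1 <= 2 * mu k) ->
  (forall k, (0 < k <= K)%N -> mu k / 8 <= T k <= 3 * mu k) ->
  \sum_(1 <= j < K.+1) walk_steps i eps alpha Y j
  <= 2 * (theta K)%:R * (288 * log_term K / eps ^+ 2 + 1).
Proof.
move=> mu0 mu2 good; have /andP[e0 e1] := eps01; have L0 := log_term_gt0 K.
have E0 : 0 < eps ^+ 2 by rewrite exprn_gt0.
pose c : R := 288 * log_term K / eps ^+ 2 + 1.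
have c0 : 0 <= c by rewrite addr_ge0// divr_ge0 ?mulr_ge0// ltW.
apply: le_trans (_ : (\sum_(1 <= j < K.+1) (theta j)%:R) * c <= _); last first.
  by rewrite ler_wpM2r// sum_theta_le.
rewrite mulr_suml !big_nat; apply: ler_sum => -[//|j] /=; rewrite ltnS => jK.
have p1 := previous_mean_ge1 j; have p0 : 0 < previous_mean j by lra.
have /andP[T1 T2] := T_hat_itv j; have T0 : 0 <= T j.+1 by lra.
have ratio : T j.+1 <= 48 * previous_mean j.
  (* In iteration 1 the preceding mean is 1 by convention and T^(1) <= 2. Later, T^(k+1) <= 3
     mu_(k+1) <= 6 mu_k <= 48 T^(k). *)
  case: j jK {p0 T1 T0} p1 T2 => [|j] jK p1 T2.
    by move: T2; rewrite /previous_mean/= /theta expn1; lra.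
  have /andP[_ g1] := good j.+2 jK.
  have /andP[g2 _] := good j.+1 (ltnW jK).
  have := mu2 j.+1; rewrite /previous_mean/=; lra.
have b0 := budget_gt0 j.+1; have /andP[_ N2] := sample_size_itv j.
apply: le_trans (_ : (budget j.+1 / previous_mean j + 1) * T j.+1 <= _).
  by rewrite /walk_steps ler_wpM2r.
(* Rounding up the sample size adds at most one walk, of average length at most [theta j.+1]; this
   is the [+ 1] in [c]. *)
apply: le_trans (_ : budget j.+1 * 48 + (theta j.+1)%:R <= _).
  rewrite mulrDl mul1r lerD// -mulrA ler_wpM2l ?(ltW b0)//.
  by rewrite mulrC ler_pdivrMr.
rewrite /c [leRHS]mulrDr mulr1 lerD2r /budget.
have Lj := log_term_le jK; have tj := theta_ge1 j.+1.
have Lj0 := log_term_gt0 j.+1.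
have -> : 3 * (1 + eps) * (theta j.+1)%:R * log_term j.+1 / eps ^+ 2 * 48 =
  (theta j.+1)%:R * ((144 * (1 + eps)) * log_term j.+1 / eps ^+ 2) by ring.
rewrite ler_wpM2l// ler_wpM2r ?invr_ge0 ?(ltW E0)//.
by apply: ler_pM => //; lra.
Qed.

End FixedTrajectories.

(** * Dependence of a run on finitely many capped return times *)

Section SameTrajectories.
Variables (Y Y' : nat -> nat -> nat -> S) (h K M : nat).
Hypotheses (Kh : (theta K <= h)%N).
Hypothesis KM : forall k, (k <= K)%N -> (size_bound k <= M)%N.
Hypothesis YY' : forall k s, (k < K)%N -> (s < M)%N ->
  hit i h (Y k.+1 s) = hit i h (Y' k.+1 s).

Let theta_le k : (k <= K)%N -> (theta k <= h)%N.
Proof. by move=> kK; apply: leq_trans Kh; rewrite leq_exp2l. Qed.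

Lemma eq_mean_length k n : (k < K)%N -> (n <= M)%N ->
  mean_length R i Y k.+1 n = mean_length R i Y' k.+1 n.
Proof.
move=> kK nM; congr (_ / _); apply: eq_bigr => s _.
have := sample_lengthE Y s (theta_le kK) => ->.
have := sample_lengthE Y' s (theta_le kK) => ->.
by rewrite YY'// (leq_trans _ nM).
Qed.

(** The mean of one iteration fixes the sample size of the next; as that size is at most [M], the
    next mean reads only samples covered by [YY']. *)
Lemma eq_sample_size_T_hat k : (k <= K)%N ->
  sample_size i eps alpha Y k = sample_size i eps alpha Y' k /\
  T_hat i eps alpha Y k = T_hat i eps alpha Y' k.
Proof.
elim: k => [|k IH] kK.
  by split=> //; rewrite /T_hat /mean_length /= !big_ord0 !mul0r.
have [_ Tk] := IH (ltnW kK).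
have sk : sample_size i eps alpha Y k.+1 = sample_size i eps alpha Y' k.+1.
  by rewrite !sample_sizeS /previous_mean Tk.
split=> //; rewrite /T_hat -sk eq_mean_length//.
exact: leq_trans (sample_size_bound Y k.+1) (KM kK).
Qed.

Lemma eq_p_hat k : (k <= K)%N ->
  p_hat i eps alpha Y k = p_hat i eps alpha Y' k.
Proof.
case: k => [_|k kK]; first by rewrite /p_hat /= !invr0 !mulr0.
have [sk _] := eq_sample_size_T_hat kK.
rewrite /p_hat -sk; congr (_%:R / _); apply: eq_bigr => s _.
rewrite !(truncatedE _ s (theta_le kK)) YY'//.
apply: leq_trans (ltn_ord s) _.
exact: leq_trans (sample_size_bound Y k.+1) (KM kK).
Qed.

Lemma eq_satisfied Delta k : (k <= K)%N ->
  satisfied i eps alpha Y Delta k = satisfied i eps alpha Y' Delta k.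
Proof.
move=> kK; have [_ Tk] := eq_sample_size_T_hat kK.
by rewrite /satisfied /pi_hat Tk (eq_p_hat kK).
Qed.

Lemma eq_first_satisfied Delta k : (k <= K)%N ->
  first_satisfied i eps alpha Y Delta k ->
  first_satisfied i eps alpha Y' Delta k.
Proof.
move=> kK [k0 sk nk]; split=> //; first by rewrite -eq_satisfied.
move=> j jk; have /andP[_ jk'] := jk.
by rewrite -eq_satisfied ?(leq_trans (ltnW jk'))//; exact: nk.
Qed.

Lemma eq_walk_steps k : (k <= K)%N ->
  walk_steps i eps alpha Y k = walk_steps i eps alpha Y' k.
Proof.
by move=> kK; have [sk Tk] := eq_sample_size_T_hat kK; rewrite /walk_steps sk Tk.
Qed.

End SameTrajectories.

End Run.

(** * Concentration of the sample means *)

Section Concentration.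
Variables (R : realType) (S : countType) (i : S) (eps alpha : R).
Hypotheses (eps01 : 0 < eps < 1) (alpha01 : 0 < alpha < 1).
Variables (d : measure_display) (Omega : measurableType d).
Variables (P : probability Omega R) (p : S -> S -> R).
Variable X : nat -> nat -> nat -> Omega -> S.
Hypothesis chainX : forall k s, markov_chain P p i (X k.+1 s).
Hypothesis indepX : independent_processes P (fun j : nat * nat => X j.1.+1 j.2).
Variable K : nat.

Let h := theta K.
Let Y (w : Omega) := fun k s t => X k s t w.

(** Index [(a, s)] stands for sample [s] of iteration [a.+1]. Values in a finite type make the
    results on i.i.d. families applicable. *)
Definition capped_return (j : nat * nat) (w : Omega) : 'I_h.+1 :=
  inord (hit i h (fun t => X j.1.+1 j.2 t w)).

Let D := capped_return.
Let q (v : 'I_h.+1) : R := pr P (D (0, 0)%N @^-1` [set v]).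

Lemma capped_returnE j w :
  D j w = hit i h (fun t => X j.1.+1 j.2 t w) :> nat.
Proof. by rewrite inordK// ltnS hit_le. Qed.

Let Q (v : 'I_h.+1) (x : nat -> S) : Prop := inord (hit i h x) = v.

Let Q_horizon v x y : same_until h x y -> Q v x -> Q v y.
Proof. by rewrite /Q => /(eq_hit i) ->. Qed.

Lemma sigma_process_capped_return j v :
  sigma_process (X j.1.+1 j.2) (D j @^-1` [set v]).
Proof. exact: (sigma_process_finite_horizon i (@Q_horizon v)).
Qed.

Lemma measurable_capped_return j v : measurable (D j @^-1` [set v]).
Proof.
apply: (markov_chain_measurable (chainX j.1 j.2)).
exact: sigma_process_capped_return.
Qed.

Lemma capped_return_law j v : pr P (D j @^-1` [set v]) = q v.
Proof.
congr fine.
exact: (markov_chain_law (@Q_horizon v) (chainX j.1 j.2) (chainX 0%N 0%N)).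
Qed.

Lemma capped_return_indep (J : seq (nat * nat)) (v : nat * nat -> 'I_h.+1) :
  uniq J -> pr P (\bigcap_(j in [set` J]) (D j @^-1` [set v j])) =
  \prod_(j <- J) q (v j).
Proof.
move=> uJ; apply: EFin_inj; rewrite -prE; last first.
  by apply: fin_bigcap_measurable => // j _; exact: measurable_capped_return.
rewrite (indepX uJ (A := fun j => D j @^-1` [set v j])); last first.
  by move=> j _; exact: sigma_process_capped_return.
rewrite -prodEFin; apply: eq_bigr => j _.
by rewrite prE ?capped_return_law//; exact: measurable_capped_return.
Qed.

Lemma capped_weight_ge0 v : 0 <= q v.
Proof. exact: pr_ge0. Qed.

Lemma capped_weight_sum1 : \sum_v q v = 1.
Proof.
have := pr_total P (measurable_capped_return (0, 0)%N) (@measurableT _ Omega).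
rewrite {1}/pr probability_setT/= => ->.
by apply: eq_bigr => v _; rewrite setTI.
Qed.

(** For [k <= K] this is E[min(T_i, theta^(k))], because return times are capped only beyond the
    largest threshold [h]. *)
Definition mean_capped (k : nat) : R :=
  \sum_v q v * (minn v.+1 (theta k))%:R.

Let mu := mean_capped.

Lemma mean_capped_ge1 k : 1 <= mu k.
Proof.
rewrite -capped_weight_sum1; apply: ler_sum => v _.
rewrite ler_peMr ?capped_weight_ge0// ler1n.
by rewrite leq_min expn_gt0.
Qed.

(** Pointwise, min(a, theta) <= min(a, 2 theta) <= 2 min(a, theta). *)
Lemma mean_cappedS k : mu k <= mu k.+1 <= 2 * mu k.
Proof.
apply/andP; split.
  apply: ler_sum => v _; rewrite ler_wpM2l ?capped_weight_ge0//.
  by rewrite ler_nat /theta expnS; lia.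
rewrite mulr_sumr; apply: ler_sum => v _.
rewrite mulrCA ler_wpM2l ?capped_weight_ge0//.
by rewrite -natrM ler_nat /theta expnS; lia.
Qed.

Definition row (k n : nat) : seq (nat * nat) := [seq (k, s) | s <- iota 0 n].

Lemma uniq_row k n : uniq (row k n).
Proof. by rewrite map_inj_uniq ?iota_uniq// => a b []. Qed.

(** Here [n] is a fixed number; the random sample size enters in [pr_failure], by splitting over its
    values. *)
Definition deviating (k n : nat) : set Omega :=
  [set w | ~ (mu k.+1 / 8 <= mean_length R i (Y w) k.+1 n <= 3 * mu k.+1)].

Lemma mean_length_capped k n w : (k < K)%N ->
  mean_length R i (Y w) k.+1 n =
  (\sum_(j <- row k n) (minn (D j w).+1 (theta k.+1))%:R) / n%:R.
Proof.
move=> kK; rewrite big_map -[n in iota 0 n]subn0 -/(index_iota 0 n) big_mkord.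
congr (_ / _); apply: eq_bigr => s _; rewrite capped_returnE.
by have := @sample_lengthE R S i (Y w) h k.+1 s => -> //; rewrite leq_exp2l.
Qed.

Lemma deviating_determined k n : (k < K)%N ->
  determined D (row k n) (deviating k n).
Proof.
move=> kK w w' ww'; rewrite /deviating /= !(mean_length_capped _ _ kK).
suff -> : \sum_(j <- row k n) (minn (D j w).+1 (theta k.+1))%:R =
  \sum_(j <- row k n) (minn (D j w').+1 (theta k.+1))%:R :> R by [].
by apply: eq_big_seq => j jr; rewrite ww'.
Qed.

(** Lengths divided by theta lie in [0, 1], and their sum has mean n mu / theta. The factor 3 in the
    budget cancels that in [3 * mu k.+1], so this mean is at least (1 + eps) / eps^2 times the log
    term. *)
Lemma pr_deviating k n : (k < K)%N -> (0 < n)%N ->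
  budget eps alpha k.+1 / (3 * mu k.+1) <= n%:R ->
  pr P (deviating k n) <= alpha / (2 * (theta k.+1)%:R).
Proof.
move=> kK n0 nb; set th : R := (theta k.+1)%:R.
have th0 : 0 < th by rewrite ltr0n expn_gt0.
have n0' : 0 < n%:R :> R by rewrite ltr0n.
have mu1 := mean_capped_ge1 k.+1; have mu0 : 0 < mu k.+1 by lra.
pose x (v : 'I_h.+1) : R := (minn v.+1 (theta k.+1))%:R / th.
have x01 v : 0 <= x v <= 1.
  by rewrite divr_ge0//= ler_pdivrMr// mul1r ler_nat geq_minr.
have mnE : mu k.+1 / th * n%:R = (\sum_v q v * x v) * (size (row k n))%:R.
  rewrite size_map size_iota; congr (_ * _); rewrite mulr_suml.
  by apply: eq_bigr => v _; rewrite mulrA.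
have := pr_mean_deviation ord0 measurable_capped_return capped_return_indep
  capped_weight_ge0 capped_weight_sum1 x01 (uniq_row k n) mnE.
have -> : [set w | ~ (mu k.+1 / th * n%:R / 8 <=
     \sum_(j <- row k n) x (D j w) <= 3 * (mu k.+1 / th * n%:R))] =
    deviating k n.
  apply/seteqP; suff E w : (mu k.+1 / th * n%:R / 8 <=
     \sum_(j <- row k n) x (D j w) <= 3 * (mu k.+1 / th * n%:R)) =
    (mu k.+1 / 8 <= mean_length R i (Y w) k.+1 n <= 3 * mu k.+1).
    by split=> w; rewrite /deviating/= E.
  have -> : \sum_(j <- row k n) x (D j w) =
      mean_length R i (Y w) k.+1 n * (n%:R / th).
    rewrite mean_length_capped// -mulr_suml mulrA divfK ?gt_eqF//.
  have r0 : 0 < n%:R / th by rewrite divr_gt0.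
  rewrite -[mu _ / 8 <= _](ler_pM2r r0) -[_ <= 3 * mu _](ler_pM2r r0).
  by congr (_ && _); congr (_ <= _); ring.
move=> /le_trans -> //.
have -> : alpha / (2 * th) = 2 * (alpha / (4 * th)) by field; lra.
rewrite -(expRN_log_term alpha01) ler_pM2l// ler_expR lerN2.
have /andP[e0 e1] := eps01; have L0 := log_term_gt0 alpha01 k.+1.
have E0 : 0 < eps ^+ 2 by rewrite exprn_gt0.
have {}nb : (1 + eps) * log_term alpha k.+1 / eps ^+ 2 <= mu k.+1 / th * n%:R.
  move: nb; rewrite ler_pdivrMr ?mulr_gt0// => nb.
  have bE : budget eps alpha k.+1 =
      3 * ((1 + eps) * log_term alpha k.+1 / eps ^+ 2 * th).
    by rewrite /budget -/th; ring.
  by rewrite [leRHS]mulrAC ler_pdivlMr//; lra.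
(* As eps < 1, 2 eps^2 <= 1 + eps; hence half the mean, the exponent in the tail bound, reaches the
   log term. *)
have : 2 * log_term alpha k.+1 <= (1 + eps) * log_term alpha k.+1 / eps ^+ 2.
  rewrite ler_pdivlMr// mulrAC ler_wpM2r ?(ltW L0)//.
  by rewrite expr2; nra.
lra.
Qed.

Definition rows (k n : nat) : seq (nat * nat) :=
  [seq (j, s) | j <- iota 0 k, s <- iota 0 n].

Lemma mem_rows k n j : (j \in rows k n) = (j.1 < k)%N && (j.2 < n)%N.
Proof.
case: j => j s; apply/allpairsP/andP => /= [[[a b] /= []]|[jk sn]].
  by rewrite !mem_iota/= !add0n => ? ? [-> ->].
by exists (j, s); rewrite /= !mem_iota/= !add0n.
Qed.

Lemma uniq_rows k n : uniq (rows k n).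
Proof. by apply: allpairs_uniq; rewrite ?iota_uniq// => -[a b] [a' b']. Qed.

(** No iteration up to [K] draws more than [M] samples, so for [k <= K] the list [rows k M] covers
    all that iterations 1 to [k] can read. *)
Let M : nat := (\max_(k < K.+1) size_bound eps alpha k)%N.

Let sizeM k : (k <= K)%N -> (size_bound eps alpha k <= M)%N.
Proof.
by rewrite -ltnS => kK; rewrite /M (leq_trans _ (leq_bigmax (Ordinal kK))).
Qed.

Lemma eq_hit_rows k w w' : {in rows k M, forall j, D j w = D j w'} ->
  forall j s, (j < k)%N -> (s < M)%N ->
  hit i h (Y w j.+1 s) = hit i h (Y w' j.+1 s).
Proof.
move=> ww' j s jk sM; have := congr1 val (ww' (j, s) _).
by rewrite /= !capped_returnE mem_rows jk sM; exact.
Qed.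

Lemma eq_T_hat_rows k w w' : (k <= K)%N ->
  {in rows k M, forall j, D j w = D j w'} ->
  T_hat i eps alpha (Y w) k = T_hat i eps alpha (Y w') k.
Proof.
move=> kK /eq_hit_rows ww'; have kh : (theta k <= h)%N by rewrite leq_exp2l.
have bM j : (j <= k)%N -> (size_bound eps alpha j <= M)%N.
  by move=> jk; apply: sizeM; exact: leq_trans kK.
by have [] := eq_sample_size_T_hat eps01 alpha01 kh bM ww' (leqnn k).
Qed.

(* The upper bound on the preceding mean makes the sample size of iteration
   [k.+1] large enough for concentration; no lower bound is needed. *)
Definition failure (k : nat) : set Omega :=
  [set w | previous_mean i eps alpha (Y w) k <= 3 * mu k.+1] `&`
  [set w | ~ (mu k.+1 / 8 <= T_hat i eps alpha (Y w) k.+1 <= 3 * mu k.+1)].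

Let small (k : nat) : set Omega :=
  [set w | previous_mean i eps alpha (Y w) k <= 3 * mu k.+1].

(** Values in a finite type allow [pr_total] to split over the sample size. *)
Let size_ (k : nat) (w : Omega) : 'I_M.+1 :=
  inord (sample_size i eps alpha (Y w) k.+1).

Let size_E k w : (k < K)%N ->
  size_ k w = sample_size i eps alpha (Y w) k.+1 :> nat.
Proof.
move=> kK; rewrite inordK// ltnS.
by apply: leq_trans (sizeM kK); exact: sample_size_bound.
Qed.

Lemma eq_previous_mean k w w' : (k < K)%N ->
  {in rows k M, forall j, D j w = D j w'} ->
  previous_mean i eps alpha (Y w) k = previous_mean i eps alpha (Y w') k.
Proof.
by move=> kK ww'; rewrite /previous_mean (eq_T_hat_rows (ltnW kK) ww').
Qed.

Lemma small_determined k : (k < K)%N -> determined D (rows k M) (small k).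
Proof. by move=> kK w w' /(eq_previous_mean kK); rewrite /small /= => ->. Qed.

Lemma size_determined k n : (k < K)%N ->
  determined D (rows k M) (size_ k @^-1` [set n]).
Proof.
move=> kK w w' /(eq_previous_mean kK) pE wn; apply: etrans wn.
by congr inord; rewrite !sample_sizeS pE.
Qed.

Lemma failure_determined k : (k < K)%N ->
  determined D (rows k.+1 M) (failure k).
Proof.
move=> kK; apply: determinedI.
  apply: sub_determined (small_determined kK) => j.
  by rewrite !mem_rows => /andP[/ltnW ? ->]; rewrite andbT ltnS.
by move=> w w' ww' /=; rewrite (eq_T_hat_rows kK ww').
Qed.

(** Split over the value [n] of the sample size. That value and the bound on the preceding mean
    depend on iterations up to [k], the deviation on iteration [k.+1] alone. By independence each
    term picks up the factor [b], and the remaining probabilities sum to at most 1. *)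
Lemma pr_failure k : (k < K)%N ->
  pr P (failure k) <= alpha / (2 * (theta k.+1)%:R).
Proof.
move=> kK; set b := _ / _.
have mD := measurable_capped_return; have iD := capped_return_indep.
have mN n : measurable (size_ k @^-1` [set n]).
  exact: (determined_measurable ord0 mD (uniq_rows k M) (size_determined kK)).
have mS : measurable (small k).
  exact: (determined_measurable ord0 mD (uniq_rows k M) (small_determined kK)).
have mF : measurable (failure k).
  exact: (determined_measurable ord0 mD (uniq_rows k.+1 M) (failure_determined kK)).
have b0 : 0 <= b.
  by rewrite /b divr_ge0 ?mulr_ge0//; case/andP: alpha01 => /ltW.
rewrite (pr_total P mN mF).
apply: (@le_trans _ _ (\sum_n pr P (small k `&` size_ k @^-1` [set n]) * b)).
  apply: ler_sum => n _.
  have FE : failure k `&` size_ k @^-1` [set n] =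
      (small k `&` size_ k @^-1` [set n]) `&` deviating k n.
    apply/seteqP; split=> w.
      move=> [[sw bw] nw]; split=> //; move: bw; rewrite /deviating /= /T_hat.
      by rewrite -size_E// nw.
    move=> [[sw nw] bw]; split=> //; split=> //; move: bw.
    by rewrite /deviating /= /T_hat -size_E// nw.
  rewrite FE (determined_indep ord0 mD iD (J1 := rows k M) (J2 := row k n)).
  (* If the event is empty both sides vanish; otherwise one outcome in it certifies that the fixed
     [n] is large enough for [pr_deviating]. *)
  - have [->|/set0P[w [sw nw]]] := eqVneq (small k `&` size_ k @^-1` [set n]) set0.
      by rewrite /pr measure0 !mul0r.
    have nE : sample_size i eps alpha (Y w) k.+1 = n by rewrite -size_E// nw.
    rewrite ler_wpM2l ?pr_ge0//; apply: pr_deviating => //.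
      by rewrite -nE sample_size_gt0.
    have /andP[lb _] := sample_size_itv i eps01 alpha01 (Y w) k.
    rewrite -nE; apply: le_trans lb.
    have p1 := previous_mean_ge1 i eps01 alpha01 (Y w) k.
    have b1 := budget_gt0 eps01 alpha01 k.+1; have m1 := mean_capped_ge1 k.+1.
    have m3 : 0 < 3 * mu k.+1 by lra.
    rewrite ler_wpM2l ?(ltW b1)// lef_pV2 ?posrE//.
    exact: lt_le_trans p1.
  - rewrite cat_uniq uniq_rows uniq_row andbT /=; apply/hasPn => j.
    by case/mapP => s _ ->; rewrite mem_rows ltnn.
  - by apply: determinedI; [exact: small_determined|exact: size_determined].
  - exact: deviating_determined.
rewrite -mulr_suml -(pr_total P mN mS) -[leRHS]mul1r ler_wpM2r//.
exact: pr_le1.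
Qed.

(** The right side is the exact value of the geometric sum of alpha / 2^(k+2) over k < n. *)
Lemma sum_pr_failure n : (n <= K)%N ->
  \sum_(k < n) pr P (failure k) <= alpha / 2 * (1 - ((theta n)%:R)^-1).
Proof.
elim: n => [|n IH] nK; first by rewrite big_ord0 /theta expn0 invr1 subrr mulr0.
rewrite big_ord_recr/=; have := IH (ltnW nK); have := pr_failure nK.
rewrite !thetaS; set t : R := (theta n)%:R; have t1 : 1 <= t := theta_ge1 R n.
have -> : alpha / 2 * (1 - (2 * t)^-1) =
    alpha / 2 * (1 - t^-1) + alpha / (2 * (2 * t)) by field; lra.
lra.
Qed.

(** Induction: T^(k) <= 3 mu_k <= 3 mu_(k+1), or the convention T^(0) = 1, puts the outcome in the
    first half of [failure k], so avoiding [failure k] excludes a deviation. *)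
Lemma good_off_failures w : (forall k, (k < K)%N -> ~ failure k w) ->
  forall k, (0 < k <= K)%N ->
    mu k / 8 <= T_hat i eps alpha (Y w) k <= 3 * mu k.
Proof.
move=> nf; elim=> [//|k IH] /= kK; apply: contrapT => nT.
apply: (nf k kK); split=> //=; have := mean_capped_ge1 k.+1.
have /andP[mk _] := mean_cappedS k; rewrite /previous_mean.
case: eqP => [_|/eqP k0]; first by rewrite -/mu; lra.
have : (0 < k <= K)%N by rewrite lt0n k0 ltnW.
by move=> /IH/andP[_ Tk] _; apply: (le_trans Tk); rewrite ler_pM2l.
Qed.

(** The complement of [E] is covered by the failures, whose probabilities sum to at most alpha / 2;
    [dE] makes [E] measurable. *)
Lemma pr_good_gt (E : set Omega) : determined D (rows K M) E ->
  (forall w, (forall k, (0 < k <= K)%N ->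
    mu k / 8 <= T_hat i eps alpha (Y w) k <= 3 * mu k) -> E w) ->
  ((1 - alpha)%:E < P E)%E.
Proof.
move=> dE goodE; have mD := measurable_capped_return.
have mE := determined_measurable ord0 mD (uniq_rows K M) dE.
have mF k : (k < K)%N -> measurable (failure k).
  move=> kK.
  exact: (determined_measurable ord0 mD (uniq_rows k.+1 M) (failure_determined kK)).
have mPB : forall n, (n <= K)%N ->
    measurable (\big[setU/set0]_(k < n) failure k) /\
    pr P (\big[setU/set0]_(k < n) failure k) <= \sum_(k < n) pr P (failure k).
  elim=> [_|n IH nK]; first by rewrite !big_ord0 /pr measure0.
  have [mn Pn] := IH (ltnW nK); rewrite !big_ord_recr/=; split.
    by apply: measurableU => //; exact: mF.
  by apply: le_trans (prU_le P mn (mF n nK)) _; rewrite lerD2r.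
have [mB PB] := mPB K (leqnn K).
have a0 : 0 < alpha by case/andP: alpha01.
have sub : ~` E `<=` \big[setU/set0]_(k < K) failure k.
  move=> w nEw; apply: contrapT => nf; apply/nEw/goodE/good_off_failures.
  move=> k kK fk; apply: nf; rewrite -bigcup_mkord; by exists k.
have PC : pr P (~` E) < alpha.
  apply: le_lt_trans (le_pr P (measurableC mE) mB sub) _.
  apply: le_lt_trans PB _; apply: le_lt_trans (sum_pr_failure (leqnn K)) _.
  have t0 : 0 < (theta K)%:R^-1 :> R by rewrite invr_gt0 ltr0n expn_gt0.
  nra.
have : P (~` E) = (1 - P E)%E by rewrite probability_setC.
rewrite !prE//; last exact: measurableC.
by rewrite -EFinB => -[EC]; rewrite lte_fin; lra.
Qed.

(** As [K] bounds the stopping iteration of every run, the event depends only on [rows K M]; on good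
    outcomes [sum_walk_steps_le] bounds the cost. *)
Lemma pr_walk_steps_le (Delta c : R) :
  (forall Y k, first_satisfied i eps alpha Y Delta k -> (k <= K)%N) ->
  (forall w k, first_satisfied i eps alpha (Y w) Delta k ->
    \sum_(1 <= j < k.+1) walk_steps i eps alpha (Y w) j
      <= 2 * (theta k)%:R * (288 * log_term alpha k / eps ^+ 2 + 1) ->
    \sum_(1 <= j < k.+1) walk_steps i eps alpha (Y w) j <= c) ->
  0 < Delta < 1 ->
  ((1 - alpha)%:E < P [set w | exists k,
     first_satisfied i eps alpha (Y w) Delta k /\
     (\sum_(1 <= j < k.+1) walk_steps i eps alpha (Y w) j <= c)%R])%E.
Proof.
move=> leK lec Delta01; apply: pr_good_gt.
  move=> w w' /eq_hit_rows ww' [k [fk ck]]; have kK := leK _ _ fk.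
  exists k; split.
    exact: (eq_first_satisfied eps01 alpha01 (leqnn h) sizeM ww' kK fk).
  apply: le_trans ck; rewrite le_eqVlt; apply/orP; left; apply/eqP.
  apply: eq_big_nat => j /andP[_ jk]; apply/esym.
  apply: (eq_walk_steps eps01 alpha01 (leqnn h) sizeM ww').
  exact: leq_trans kK.
move=> w good.
have [k fk] := first_satisfied_exists i eps01 alpha01 (Y w) Delta01.
exists k; split=> //; apply: lec => //.
apply: (@sum_walk_steps_le _ _ _ _ _ eps01 alpha01 _ mu) => //.
- by move=> j; apply: lt_le_trans (mean_capped_ge1 j).
- by move=> j; have /andP[] := mean_cappedS j.
move=> j /andP[j0 jk]; apply: good; rewrite j0 (leq_trans jk)//.
exact: leK fk.
Qed.

End Concentration.

(** * The cost bound *)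

Section SoftBigO.
Variable R : realType.
Implicit Types a eps alpha Delta : R.

Definition inv_cube_rate (b : R * R) : R := 1 / (b.1 ^+ 3 * b.2).

(* [3468 = 2 * 6 * (288 + 1)]: [6] comes from [theta k <= 6 / (eps * Delta)]. *)
Definition accuracy_factor (b : R * R) : R :=
  3468 * inv_cube_rate b * (1 + ln 24 + ln (inv_cube_rate b)).

Definition confidence_factor a : R := 1 + ln (1 / a).

(** Where ln (1 / a) >= c, the summand 1 is at most c^-1 ln (1 / a). *)
Lemma soft_bigO_confidence_factor :
  soft_bigO [set a : R | 0 < a < 1] confidence_factor (fun a => ln (1 / a)).
Proof.
exists 1%:P => c c0; exists (1 + c^-1) => a _ ca; have l0 := lt_le_trans c0 ca.
rewrite hornerC mulr1 /confidence_factor.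
move: (ln (1 / a)) ca l0 => l cl l0.
rewrite !ger0_norm ?addr_ge0 ?(ltW l0)//.
have : 1 <= c^-1 * l by rewrite mulrC ler_pdivlMr// mul1r.
lra.
Qed.

Lemma soft_bigO_accuracy_factor :
  soft_bigO [set b : R * R | 0 < b.1 < 1 /\ 0 < b.2 < 1] accuracy_factor
    inv_cube_rate.
Proof.
exists ((1 + ln 24)%:P + 'X) => c c0; exists `|3468| => b _ _.
by rewrite hornerD hornerC hornerX -normrM mulrA.
Qed.

Lemma ln_inv_ge0 a : 0 < a < 1 -> 0 <= ln (1 / a).
Proof.
by move=> /andP[a0 a1]; apply: ln_ge0; rewrite ler_pdivlMr// mul1r ltW.
Qed.

Lemma steps_le_factors eps alpha Delta (k : nat) :
  0 < eps < 1 -> 0 < alpha < 1 -> 0 < Delta < 1 -> (0 < k)%N ->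
  (2 ^ k.-1)%:R <= 3 * (1 + eps) / (2 * eps * Delta) ->
  2 * (theta k)%:R * (288 * log_term alpha k / eps ^+ 2 + 1)
  <= confidence_factor alpha * accuracy_factor (eps, Delta).
Proof.
move=> /andP[e0 e1] alpha01 /andP[D0 D1] k0 kB.
have /andP[a0 a1] := alpha01.
set f := inv_cube_rate (eps, Delta).
have eD0 : 0 < eps * Delta by rewrite mulr_gt0.
have E0 : 0 < eps ^+ 2 by rewrite exprn_gt0.
have E1 : eps ^+ 2 <= 1 by rewrite exprn_ile1// ltW.
have thk : (theta k)%:R * (eps * Delta) <= 6.
  case: k k0 kB => // k _ /=; rewrite thetaS.
  by rewrite ler_pdivlMr ?mulr_gt0// -/(theta k) /theta; lra.
have fE : f * (eps ^+ 2 * (eps * Delta)) = 1.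
  by rewrite /f /inv_cube_rate /=; field; rewrite !gt_eqF.
have f1 : 1 <= f.
  have f0 : 0 <= f by rewrite /f /inv_cube_rate/= divr_ge0 ?mulr_ge0 ?exprn_ge0 ?ltW.
  rewrite -[leLHS]fE ler_piMr//; nra.
have g0 : 0 <= ln f by exact: ln_ge0.
have l0 : 0 <= ln (1 / alpha) by exact: ln_inv_ge0.
have h0 : 0 <= ln 24 :> R by apply: ln_ge0; rewrite ler1n.
have th := theta_ge1 R k.
have thf : (theta k)%:R <= 6 * f * eps ^+ 2.
  rewrite -(ler_pM2r eD0); have -> : 6 * f * eps ^+ 2 * (eps * Delta) = 6.
    by rewrite -[RHS]mulr1 -fE; ring.
  exact: thk.
(* 24 = 4 * 6: the argument of the logarithm is at most 24 f eps^2 / alpha <= 24 f / alpha. *)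
have L_le : log_term alpha k <= ln 24 + ln f + ln (1 / alpha).
  have f0 : 0 < f by lra.
  have i0 : 0 < 1 / alpha by rewrite divr_gt0.
  have f24 : 0 < 24 * f by rewrite mulr_gt0.
  have lnM2 : ln (24 * f * (1 / alpha)) = ln 24 + ln f + ln (1 / alpha).
    by rewrite lnM ?posrE// lnM ?posrE.
  rewrite /log_term -lnM2 ler_ln ?posrE; last 2 first.
  - by rewrite divr_gt0//; lra.
  - by rewrite mulr_gt0.
  rewrite mul1r ler_pM2r ?invr_gt0//.
  have : f * eps ^+ 2 <= f by rewrite ler_piMr// ltW.
  lra.
(* The product dominates the sum of ln (1 / alpha) and ln 24 + ln f, which separates alpha from
   (eps, Delta). *)
set c := (1 + ln (1 / alpha)) * (1 + ln 24 + ln f).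
have c1 : 1 <= c by rewrite /c; nra.
have Lc : log_term alpha k <= c by apply: le_trans L_le _; rewrite /c; nra.
have -> : confidence_factor alpha * accuracy_factor (eps, Delta) =
    3468 * f * c.
  by rewrite /confidence_factor /accuracy_factor -/f /c; ring.
have bc : 288 * log_term alpha k / eps ^+ 2 + 1 <= 289 * c / eps ^+ 2.
  rewrite -(ler_pM2r E0) mulrDl mul1r !divfK ?gt_eqF//; lra.
apply: (@le_trans _ _ (2 * (6 * f * eps ^+ 2) * (289 * c / eps ^+ 2))).
  apply: ler_pM => //.
    by rewrite addr_ge0// divr_ge0 ?mulr_ge0 ?(ltW (log_term_gt0 alpha01 k))// ltW.
  by rewrite ler_pM2l.
rewrite le_eqVlt; apply/orP; left; apply/eqP.
by field; rewrite gt_eqF.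
Qed.

End SoftBigO.

Theorem theorem10 (R : realType) :
  exists (F : R -> R) (G : R * R -> R),
    [/\ soft_bigO [set a : R | 0 < a < 1] F (fun a => ln (1 / a)),
        soft_bigO [set b : R * R | 0 < b.1 < 1 /\ 0 < b.2 < 1] G
          (fun b => 1 / (b.1 ^+ 3 * b.2)) &
        forall (S : countType) (p : S -> S -> R) (i : S) (eps alpha Delta : R)
          (d : measure_display) (Omega : measurableType d)
          (P : probability Omega R) (X : nat -> nat -> nat -> Omega -> S),
          stochastic p -> irreducible p -> positive_recurrent p ->
          0 < eps < 1 -> 0 < alpha < 1 -> 0 < Delta < 1 ->
          (forall k s, markov_chain P p i (X k.+1 s)) ->
          independent_processes P (fun j : nat * nat => X j.1.+1 j.2) ->
          {ae P, forall w, exists k : nat,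
             first_satisfied i eps alpha (fun k s t => X k s t w) Delta k /\
             k.-1%:R <= ln (3 * (1 + eps) / (2 * eps * Delta)) / ln 2}
          /\
          ((1 - alpha)%:E <
           P [set w | exists k : nat,
                first_satisfied i eps alpha (fun k s t => X k s t w) Delta k /\
                (\sum_(1 <= j < k.+1)
                    walk_steps i eps alpha (fun k s t => X k s t w) j
                   <= F alpha * G (eps, Delta))%R])%E].
Proof.
exists (@confidence_factor R), (@accuracy_factor R); split.
- exact: soft_bigO_confidence_factor.
- exact: soft_bigO_accuracy_factor.
move=> S p i eps alpha Delta d Omega P X _ _ _ eps01 alpha01 Delta01 chainX indepX.
set B : R := 3 * (1 + eps) / (2 * eps * Delta).
have B0 : 0 < B.
  case/andP: eps01 Delta01 => e0 _ /andP[D0 _].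
  by rewrite divr_gt0 ?mulr_gt0//; lra.
have pow_le Y k : first_satisfied i eps alpha Y Delta k -> (2 ^ k.-1)%:R <= B.
  exact: first_satisfied_theta_le.
split.
  apply: aeW => w; set Y := fun k s t => X k s t w.
  have [k fk] := first_satisfied_exists i eps01 alpha01 Y Delta01.
  exists k; split=> //; have ln2 : 0 < ln 2 :> R by apply: ln_gt0; rewrite ltr1n.
  rewrite ler_pdivlMr// mulr_natl -lnXn// -natrX ler_ln ?posrE//.
  exact: pow_le fk.
(* Since k - 1 < 2^(k-1) <= B, every stopping iteration is at most [Num.bound B]; this choice of [K]
   fixes the common horizon 2^K. *)
apply: (pr_walk_steps_le eps01 alpha01 chainX indepX (K := Num.bound B)) => //.
  move=> Y k fk; have [k0 _ _] := fk; rewrite -(prednK k0).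
  have := le_lt_trans (pow_le _ _ fk) (archi_boundP (ltW B0)).
  by rewrite ltr_nat; apply: leq_ltn_trans; rewrite ltnW// ltn_expl.
move=> w k fk /le_trans -> //; have [k0 _ _] := fk.
exact: (steps_le_factors eps01 alpha01 Delta01 k0 (pow_le _ _ fk)).
Qed.
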